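(* Let $k\ge 3$ and $m\ge 2$ be integers and let $\mu>0$. Then there exists $n_0$ such that for every $n\ge n_0$ there exists a $(\frac12,\mu)$-dense $k$-partite $k$-graph $H$, each of whose parts has exactly $n$ vertices, such that $\delta'_{k-1}(H)\ge(\frac12-\mu)n$ and $H$ has no $K_k(m)$-factor.
   Context: A $k$-graph $H$ has a vertex set $V(H)$ and an edge set $E(H)$ consisting of $k$-element subsets of $V(H)$. A $k$-partite $k$-graph comes with a fixed partition $V(H)=V_1\cup\dots\cup V_k$ (its parts) such that every edge meets each $V_i$ in at most one vertex. A set $S\subseteq V(H)$ is legal if $|S\cap V_i|\le 1$ for all $i$. For $S\subseteq V(H)$ with $|S|=s<k$, $\deg_H(S)$ is the number of $(k-s)$-sets $S'$ with $S\cup S'\in E(H)$. The partite minimum $s$-degree $\delta'_s(H)$ is the minimum of $\deg_H(S)$ over all legal $s$-subsets $S$. A $k$-partite $k$-graph $H$ with parts $V_1,\dots,V_k$ and $N=|V(H)|$ vertices is $(p,\mu)$-dense if for all $X_1\subseteq V_1,\dots,X_k\subseteq V_k$ we have $e_H(X_1,\dots,X_k)\ge p|X_1|\cdots|X_k|-\mu N^k$, where $e_H(X_1,\dots,X_k)$ is the number of $(x_1,\dots,x_k)\in X_1\times\dots\times X_k$ with $\{x_1,\dots,x_k\}\in E(H)$. $K_k(m)$ denotes the complete $k$-partite $k$-graph with each part of size $m$. An $F$-factor in $H$ is a set of pairwise vertex-disjoint subgraphs of $H$, each isomorphic to $F$, covering $V(H)$. *)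

(* Defs.v *)
From HB Require Import structures.
From mathcomp Require Import all_boot all_order all_algebra.
From mathcomp Require Import reals.
Set Implicit Arguments. Unset Strict Implicit. Unset Printing Implicit Defensive.
Import Order.TTheory GRing.Theory Num.Theory.
Local Open Scope ring_scope.

(* A k-partite k-graph whose k parts all have n vertices: the vertex set is
   'I_k * 'I_n, part V_i = { v | v.1 = i }, and the edge set E is a set of
   k-element vertex sets, each meeting every part in at most one vertex. *)

Definition part (k n : nat) (i : 'I_k) : {set 'I_k * 'I_n} :=
  [set v | v.1 == i].

Definition legal (k n : nat) (S : {set 'I_k * 'I_n}) : bool :=
  [forall i : 'I_k, (#|S :&: part n i| <= 1)%N].

Definition is_kpartite_kgraph (k n : nat) (E : {set {set 'I_k * 'I_n}}) : Prop :=
  forall e, e \in E -> #|e| = k /\ legal e.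

Definition deg (k n : nat) (E : {set {set 'I_k * 'I_n}}) (S : {set 'I_k * 'I_n}) : nat :=
  #|[set S' : {set 'I_k * 'I_n} | (#|S'| == k - #|S|)%N && (S :|: S' \in E)]|.

Definition partite_min_deg_ge (R : realType) (k n : nat)
    (E : {set {set 'I_k * 'I_n}}) (s : nat) (d : R) : Prop :=
  forall S : {set 'I_k * 'I_n}, legal S -> #|S| = s -> d <= (deg E S)%:R.

Definition e_H (k n : nat) (E : {set {set 'I_k * 'I_n}})
    (X : 'I_k -> {set 'I_k * 'I_n}) : nat :=
  #|[set f : {ffun 'I_k -> 'I_k * 'I_n} |
       [forall i, f i \in X i] && ([set f i | i in 'I_k] \in E)]|.

(* (p,mu)-dense, with N = |V(H)| = k*n *)
Definition dense (R : realType) (k n : nat) (E : {set {set 'I_k * 'I_n}})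
    (p mu : R) : Prop :=
  forall X : 'I_k -> {set 'I_k * 'I_n},
    (forall i, X i \subset part n i) ->
    p * (\prod_(i < k) (#|X i|%:R : R)) - mu * ((k * n)%N%:R : R) ^+ k
      <= (e_H E X)%:R.

Definition Kkm_edges (k m : nat) : {set {set 'I_k * 'I_m}} :=
  [set e : {set 'I_k * 'I_m} | (#|e| == k) && legal e].

(* phi embeds K_k(m) as a (not necessarily induced) subgraph of H:
   phi is injective on vertices and maps edges of K_k(m) to edges of H.
   The subgraph (phi(V(K)), phi(E(K))) is then isomorphic to K_k(m). *)
Definition is_Kkm_copy (k n m : nat) (E : {set {set 'I_k * 'I_n}})
    (phi : 'I_k * 'I_m -> 'I_k * 'I_n) : Prop :=
  injective phi /\ forall e, e \in Kkm_edges k m -> phi @: e \in E.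

Definition has_Kkm_factor (k n m : nat) (E : {set {set 'I_k * 'I_n}}) : Prop :=
  exists (t : nat) (phi : 'I_t -> 'I_k * 'I_m -> 'I_k * 'I_n),
    (forall j, is_Kkm_copy E (phi j)) /\
    (forall j j', j != j' -> [disjoint [set phi j x | x in [set: 'I_k * 'I_m]]
                                   & [set phi j' x | x in [set: 'I_k * 'I_m]]]) /\
    (forall v : 'I_k * 'I_n, exists j x, phi j x = v).

(* Main.v *)
Require Import Defs.
From HB Require Import structures.
From mathcomp Require Import all_boot all_order all_algebra.
From mathcomp Require Import reals.
From mathcomp Require Import ring lra zify.
Import Order.TTheory GRing.Theory Num.Theory.
Local Open Scope ring_scope.
Set Implicit Arguments. Unset Strict Implicit. Unset Printing Implicit Defensive.

(** The edges are the [(x_1, ..., x_k)] with [side x_1 * f (c x_2 + ... + c x_k) = 1].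
    Here [side] is the sign of a bipartition [V_1 = A + ~: A] with [#|A|] close
    to [n / 2] and not divisible by [m], [c] colors ['I_n] almost equitably by
    the group [(Z/4)^d], and [f = +-1] is a function on that group with
    perfect autocorrelation (a power of the pattern 1, 1, 1, -1 on [Z/4]).
    Two vertices of [V_1] sharing a link edge lie on the same side, so each
    copy of [K_k(m)] meets [A] in [0] or [m] vertices, and a factor would force
    [m] to divide [#|A|].  Perfect autocorrelation makes the matrix [f (a + b)]
    orthogonal up to scaling, which bounds the discrepancy of every box as soon
    as two coordinates besides [x_1] are available; since [f] is almost
    balanced, so are the degrees. *)

(** * A sign function on [(Z/4)^d] with perfect autocorrelation *)

Section Bent.
Variables (R : realFieldType) (d : nat).
Local Notation A := {ffun 'I_d -> 'Z_4}.

Definition bent4 (c : 'Z_4) : R := (-1) ^+ (c == 3).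

Definition bent (u : A) : R := \prod_i bent4 (u i).

Lemma bent_sqr u : bent u ^+ 2 = 1.
Proof. by rewrite /bent -prodrXl big1 // => i _; rewrite /bent4 sqrr_sign. Qed.

Lemma sum_Z4 (F : 'Z_4 -> R) : \sum_c F c = F 0 + F 1 + F 2 + F 3.
Proof.
rewrite !big_ord_recr big_ord0 /= add0r.
by congr (F _ + F _ + F _ + F _); apply/val_inj.
Qed.

(** The sum factors over the coordinates, each giving 1 + 1 + 1 - 1 = 2. The result is only the
    square root of the number of terms. *)
Lemma sum_bent : \sum_u bent u = 2 ^+ d.
Proof.
rewrite -(bigA_distr_bigA (fun _ : 'I_d => bent4)) /=.
rewrite (eq_bigr (fun=> 2)) ?prodr_const ?card_ord // => i _.
by rewrite sum_Z4 /bent4 /= expr0 expr1; lra.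
Qed.

(** Distinct shifts put the value -1 at different places, so two of the four products are -1 and two
    are 1. *)
Lemma bent4_autocorr s t :
  \sum_c bent4 (c + s) * bent4 (c + t) = if s == t then 4 else 0.
Proof.
rewrite sum_Z4 /bent4.
by case: s => [[|[|[|[|//]]]] ?]; case: t => [[|[|[|[|//]]]] ?];
  rewrite /= ?expr0 ?expr1 //=; lra.
Qed.

Lemma bent_autocorr (s t : A) :
  \sum_(u : A) bent (u + s) * bent (u + t) = if s == t then 4 ^+ d else 0.
Proof.
transitivity (\prod_i \sum_c bent4 (c + s i) * bent4 (c + t i)).
  rewrite bigA_distr_bigA /=; apply: eq_bigr => u _.
  by rewrite -big_split /=; apply: eq_bigr => i _; rewrite !ffunE.
under eq_bigr do rewrite bent4_autocorr.
have [<-|neq] := eqVneq s t.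
  by under eq_bigr do rewrite eqxx; rewrite prodr_const card_ord.
have [i neqi] : exists i, s i != t i.
  apply/existsP; apply: contraNT neq => /existsPn eq_st.
  by apply/eqP/ffunP => i; apply/eqP; rewrite -[_ == _]negbK.
by rewrite (bigD1 i) //= (negPf neqi) mul0r.
Qed.

(* AM-GM with weight [2 ^ d] replaces Cauchy-Schwarz: both resulting sums of
   squares contribute the same amount. *)
Lemma bent_bilinear (w z : A -> R) (W : R) (s : A) :
  (forall a, `|w a| <= W) -> (forall a, `|z a| <= W) ->
  `|\sum_(a : A) \sum_(b : A) w a * z b * bent (a + b + s)| <= 2 ^+ d * 4 ^+ d * W ^+ 2.
Proof.
move=> leW lez.
have sqW (v : A -> R) : (forall a, `|v a| <= W) ->
    \sum_a v a ^+ 2 <= 4 ^+ d * W ^+ 2.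
  move=> lev; apply: (@le_trans _ _ (\sum_(a : A) W ^+ 2)).
    apply: ler_sum => a _; rewrite -real_normK ?num_real //.
    by rewrite ler_sqr ?nnegrE // (le_trans _ (lev a)).
  by rewrite sumr_const card_ffun !card_ord -[_ *+ _]mulr_natl natrX.
pose F (a : A) := \sum_(b : A) z b * bent (a + b + s).
(* Parseval: in the expanded square, [bent_autocorr] kills all terms with [b' != b]. *)
have sqF : \sum_a F a ^+ 2 = 4 ^+ d * \sum_b z b ^+ 2.
  transitivity (\sum_b \sum_b' z b * z b' *
      \sum_(a : A) bent (a + (b + s)) * bent (a + (b' + s))).
    under eq_bigr do rewrite expr2 /F big_distrlr /=.
    rewrite exchange_big; apply: eq_bigr => b _ /=.
    rewrite exchange_big; apply: eq_bigr => b' _ /=.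
    by rewrite big_distrr; apply: eq_bigr => a _ /=; rewrite !addrA; ring.
  rewrite big_distrr; apply: eq_bigr => b _ /=.
  rewrite (bigD1 b) //= bent_autocorr eqxx big1 => [|b' neq]; first by ring.
  by rewrite bent_autocorr (inj_eq (addIr _)) eq_sym (negPf neq) mulr0.
have p2 : 0 < 2 ^+ d :> R by rewrite exprn_gt0.
have e4 : 4 ^+ d = 2 ^+ d * 2 ^+ d :> R by rewrite -exprMn; congr (_ ^+ _); lra.
have -> : \sum_(a : A) \sum_(b : A) w a * z b * bent (a + b + s) = \sum_a w a * F a.
  by apply: eq_bigr => a _; rewrite big_distrr /=; apply: eq_bigr => b _; ring.
apply: le_trans (ler_norm_sum _ _ _) _.
apply: (@le_trans _ _
    (\sum_a (2 ^+ d * w a ^+ 2 / 2 + (2 ^+ d)^-1 * F a ^+ 2 / 2))).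
  apply: ler_sum => a _; rewrite -(ler_pM2l p2).
  have -> : 2 ^+ d * (2 ^+ d * w a ^+ 2 / 2 + (2 ^+ d)^-1 * F a ^+ 2 / 2)
      = ((2 ^+ d * w a) ^+ 2 + F a ^+ 2) / 2 by field; lra.
  rewrite -[X in X * _](gtr0_norm p2) -normrM mulrA.
  by rewrite ler_norml; have := sqr_ge0 (2 ^+ d * w a - F a);
    have := sqr_ge0 (2 ^+ d * w a + F a); nra.
rewrite big_split /= -!mulr_suml -!mulr_sumr sqF.
have -> : (2 ^+ d)^-1 * (4 ^+ d * \sum_b z b ^+ 2) = 2 ^+ d * \sum_b z b ^+ 2.
  by rewrite e4; field; lra.
have := sqW w leW; have := sqW z lez; nra.
Qed.

End Bent.

(** * Equitable colorings *)

Lemma count_modn_eq (N r n : nat) : (r < N)%N ->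
  (\sum_(i < n) (i %% N == r))%N = ((n + (N.-1 - r)) %/ N)%N.
Proof.
move=> ltrN; elim: n => [|n IHn]; first by rewrite big_ord0 divn_small //; lia.
(* The quotient grows exactly when [N] divides [n + N - r], that is, when [n] is congruent to [r]
   modulo [N]. *)
rewrite big_ord_recr /= IHn addSn divnS; last by lia.
rewrite addnC; congr (_ + _)%N; congr nat_of_bool.
have -> : (n + (N.-1 - r)).+1 = (n + N - r)%N by lia.
rewrite -(eqn_mod_dvd N); last by lia.
by rewrite modnDr (modn_small ltrN).
Qed.

(** Coloring [x] by its residue modulo [#|T|] makes every class size [n / #|T|] rounded up or
    down. *)
Lemma equitable_coloring (R : realFieldType) (T : finType) (n : nat) :
  (0 < #|T|)%N ->
  exists c : 'I_n -> T,
    forall a, `|(#|[pred x | c x == a]|%:R : R) - n%:R / #|T|%:R| <= 1.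
Proof.
move=> T0; pose c (x : 'I_n) := enum_val (Ordinal (ltn_pmod x T0)).
exists c => a; pose r := nat_of_ord (enum_rank a).
have ltr : (r < #|T|)%N := ltn_ord _.
have -> : #|[pred x | c x == a]| = ((n + (#|T|.-1 - r)) %/ #|T|)%N.
  rewrite -(count_modn_eq _ ltr) -sum1_card big_mkcond /=.
  apply: eq_bigr => x _; rewrite inE /c.
  by rewrite -(can_eq enum_rankK) enum_valK -val_eqE /= ; case: eqP.
clearbody r; clear c; set N := #|T| in T0 ltr *; set q := (_ %/ _)%N.
have N0 : 0 < N%:R :> R by rewrite ltr0n.
have lb : (q * N <= n + N)%N by have := leq_trunc_div (n + (N.-1 - r)) N; lia.
have ub : (n <= q * N + N)%N by have := ltn_ceil (n + (N.-1 - r)) T0; lia.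
rewrite -(ler_pM2r N0) -{2}(gtr0_norm N0) -normrM mulrBl divfK ?gt_eqF //.
move: lb ub; rewrite -(ler_nat R) -[(n <= _)%N](ler_nat R) !natrD natrM mul1r.
by rewrite ler_norml => lb ub; apply/andP; split; lra.
Qed.

(** * Legal [k]-sets as points of a grid *)

Section Transversal.
Variables (k n : nat).
Local Notation point := {ffun 'I_k -> 'I_n}.

(** Legal [k]-sets are the graphs of points [g], so a predicate on points encodes a [k]-partite
    [k]-graph and edge counts become point counts. *)
Definition transversal (g : point) : {set 'I_k * 'I_n} := [set (i, g i) | i in 'I_k].

Definition transversal_edges (P : pred point) : {set {set 'I_k * 'I_n}} :=
  [set transversal g | g in P].

Definition upd (g : point) (j : 'I_k) (x : 'I_n) : point :=
  [ffun i => if i == j then x else g i].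

Lemma upd_same g j x : upd g j x j = x.
Proof. by rewrite ffunE eqxx. Qed.

Lemma upd_other g j x i : i != j -> upd g j x i = g i.
Proof. by rewrite ffunE => /negPf->. Qed.

Lemma upd_id g j : upd g j (g j) = g.
Proof. by apply/ffunP => i; rewrite ffunE; case: eqP => [->|]. Qed.

Lemma upd_upd g j x y : upd (upd g j x) j y = upd g j y.
Proof. by apply/ffunP => i; rewrite !ffunE; case: eqP. Qed.

Lemma mem_transversal g v : (v \in transversal g) = (v.2 == g v.1).
Proof.
apply/imsetP/eqP => [[i _ ->] //|]; case: v => i x /= ->.
by exists i.
Qed.

Lemma transversal_inj : injective transversal.
Proof.
move=> g h eq_gh; apply/ffunP => i; apply/eqP.
by rewrite -(mem_transversal h (i, g i)) -eq_gh mem_transversal.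
Qed.

Lemma mem_transversal_edges P g : (transversal g \in transversal_edges P) = P g.
Proof. exact: (mem_imset _ _ transversal_inj). Qed.

Lemma card_transversal g : #|transversal g| = k.
Proof. by rewrite card_imset ?card_ord // => i j []. Qed.

Lemma legal_transversal g : legal (transversal g).
Proof.
apply/forallP => i; apply/card_le1P => u; rewrite !inE => /andP[].
case: u => a x; rewrite mem_transversal /= => /eqP-> /eqP-> [b y].
rewrite !inE mem_transversal /= xpair_eqE.
by case: (eqVneq b i) => [->|]; rewrite ?andbT ?andbF.
Qed.

Lemma transversal_edges_kpartite P : is_kpartite_kgraph (transversal_edges P).
Proof. by move=> e /imsetP[g _ ->]; rewrite card_transversal legal_transversal. Qed.

(** As [X i] lies in part [i], every counted tuple sends [i] to some [(i, g i)] and so amounts to a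
    point [g]. *)
Lemma e_H_transversal_edges P (X : 'I_k -> {set 'I_k * 'I_n}) :
  (forall i, X i \subset part n i) ->
  e_H (transversal_edges P) X = #|[set g : point | [forall i, (i, g i) \in X i] && P g]|.
Proof.
move=> subX; pose lift_pt (g : point) : {ffun 'I_k -> 'I_k * 'I_n} := [ffun i => (i, g i)].
have lift_inj : injective lift_pt.
  by move=> g h /ffunP eq_gh; apply/ffunP => i; have := eq_gh i; rewrite !ffunE => -[].
have im_lift g : [set lift_pt g i | i in 'I_k] = transversal g.
  by apply: eq_imset => i; rewrite ffunE.
rewrite -(card_imset _ lift_inj) /e_H; apply: eq_card => f; rewrite !inE.
apply/andP/imsetP => [[/forallP fX fE]|[g]].
  have f1 i : (f i).1 = i.
    by have /(subsetP (subX i)) := fX i; rewrite inE => /eqP.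
  pose g : point := [ffun i => (f i).2].
  have fg : f = lift_pt g.
    by apply/ffunP => i; rewrite !ffunE -{2}(f1 i) -surjective_pairing.
  exists g => //; rewrite inE -mem_transversal_edges -im_lift -fg fE andbT.
  by apply/forallP => i; have := fX i; rewrite {1}fg ffunE.
rewrite inE => /andP[/forallP gX Pg] ->.
rewrite im_lift mem_transversal_edges; split=> //.
by apply/forallP => i; rewrite ffunE.
Qed.

(** With [k - 1] vertices in distinct parts, [S] misses exactly one part [j]. *)
Lemma legal_partial_transversal (S : {set 'I_k * 'I_n}) :
  (0 < k)%N -> (0 < n)%N -> legal S -> #|S| = k.-1 ->
  exists (g : point) (j : 'I_k), S = transversal g :\ (j, g j).
Proof.
move=> k0 n0 /forallP legS cardS.
have inj1 : {in S &, injective fst}.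
  move=> u v uS vS euv.
  have := legS u.1 => /card_le1_eqP; apply; by rewrite !inE ?uS ?vS ?euv eqxx.
have cardI : #|fst @: S| = k.-1 by rewrite card_in_imset.
have [j Ij] : exists j, j \notin fst @: S.
  apply/existsP; apply: contraLR k0 => /existsPn allI.
  have : [set: 'I_k] \subset fst @: S.
    by apply/subsetP => i _; have := allI i; rewrite negbK.
  by move/subset_leq_card; rewrite cardsT card_ord cardI; lia.
have SI i : i != j -> exists x, (i, x) \in S.
  move=> neq; suff : i \in fst @: S.
    by case/imsetP => -[a x] uS ->; exists x.
  have /eqP-> : fst @: S == ~: [set j].
    rewrite eqEcard cardsC1 card_ord cardI leqnn andbT.
    by apply/subsetP => i' i'S; rewrite !inE; apply: contraNneq Ij => <-.
  by rewrite !inE.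
(* The default [Ordinal n0] is reached only at [j], whose vertex is removed again. *)
pose g : point := [ffun i => odflt (Ordinal n0) [pick x | (i, x) \in S]].
have gS i : i != j -> (i, g i) \in S.
  move=> /SI[x xS]; rewrite ffunE; case: pickP => //= noS.
  by have := noS x; rewrite xS.
exists g, j; apply/setP => -[i x]; rewrite !inE mem_transversal xpair_eqE /=.
have [->|neq] /= := eqVneq i j.
  rewrite andNb; apply: contraNF Ij => /(imset_f fst); exact: id.
apply/idP/eqP => [xS|->]; last exact: gS.
by have [] := inj1 (i, x) (i, g i) xS (gS i neq) erefl.
Qed.

(** Distinct [x] give distinct completing singletons [(j, x)]; a lower bound is enough for the
    minimum degree. *)
Lemma deg_transversal_edges P (S : {set 'I_k * 'I_n}) :
  (0 < k)%N -> (0 < n)%N -> legal S -> #|S| = k.-1 ->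
  exists (g : point) (j : 'I_k),
    (#|[pred x | P (upd g j x)]| <= deg (transversal_edges P) S)%N.
Proof.
move=> k0 n0 legS cardS; have [g [j defS]] := legal_partial_transversal k0 n0 legS cardS.
exists g, j; have inj1 : injective (fun x : 'I_n => [set (j, x)]).
  by move=> x y /set1_inj[].
rewrite -(card_imset _ inj1); apply/subset_leq_card/subsetP => _ /imsetP[x Px ->].
rewrite inE cards1 cardS -subn1 subKn // eqxx /=.
suff -> : S :|: [set (j, x)] = transversal (upd g j x) by rewrite mem_transversal_edges.
apply/setP => -[i y]; rewrite defS !inE !mem_transversal !xpair_eqE /=.
have [->|neq] /= := eqVneq i j; first by rewrite andNb upd_same.
by rewrite upd_other ?orbF.
Qed.

End Transversal.

(** * Copies of [K_k(m)] and divisibility by [m] *)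

Section Factor.
Variables (k n m : nat) (P : pred {ffun 'I_k -> 'I_n}).
Hypothesis m0 : (0 < m)%N.

Lemma Kkm_copy_transversal (phi : 'I_k * 'I_m -> 'I_k * 'I_n) (h : {ffun 'I_k -> 'I_m}) :
  is_Kkm_copy (transversal_edges P) phi ->
  exists2 g, P g & phi @: transversal h = transversal g.
Proof.
case=> _ /(_ (transversal h)).
rewrite inE card_transversal eqxx legal_transversal => /(_ isT) /imsetP[g Pg ->].
by exists g.
Qed.

(* Two vertices of the same part of [K_k(m)] lie in edges that differ only
   there, so their images lie in the unique part missed by the common rest. *)
Lemma Kkm_copy_parts (phi : 'I_k * 'I_m -> 'I_k * 'I_n) :
  is_Kkm_copy (transversal_edges P) phi ->
  exists2 p : 'I_k -> 'I_k, injective p & forall i x, (phi (i, x)).1 = p i.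
Proof.
move=> copy; have [injphi _] := copy.
have inj_part (h : {ffun 'I_k -> 'I_m}) : injective (fun i => (phi (i, h i)).1).
  have [g _ im] := Kkm_copy_transversal h copy.
  have imP i : (phi (i, h i)).2 = g (phi (i, h i)).1.
    by apply/eqP; rewrite -mem_transversal -im imset_f // mem_transversal.
  move=> i j /= eq1; suff /injphi[] : phi (i, h i) = phi (j, h j) by [].
  by rewrite [LHS]surjective_pairing [RHS]surjective_pairing !imP eq1.
exists (fun i => (phi (i, Ordinal m0)).1).
  by move=> i j; have := @inj_part [ffun=> Ordinal m0] i j; rewrite !ffunE.
move=> i x; pose h : {ffun 'I_k -> 'I_m} := [ffun=> Ordinal m0].
have [p' _ pK] := injF_bij (inj_part h).
(* The edge of [h] has a vertex, at [j], sent to the same part as [(i, x)]. If [j != i], then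
   [upd h i x] is an edge with two vertices sent to one part. *)
have := pK (phi (i, x)).1; set j := p' _; rewrite ffunE => eqj.
have [eji|neq] := eqVneq j i; first by rewrite -eqj eji.
have := @inj_part (upd h i x) j i.
by rewrite upd_same upd_other // ffunE eqj => /(_ erefl)/eqP; rewrite (negPf neq).
Qed.

Variables (i0 : 'I_k) (A : {set 'I_n}).
Hypothesis P_determines : forall g g', P g -> P g' ->
  (forall i, i != i0 -> g i = g' i) -> (g i0 \in A) = (g' i0 \in A).

Let VA := [set v : 'I_k * 'I_n | (v.1 == i0) && (v.2 \in A)].

(** Two edges of [K_k(m)] through [(i, x)] and [(i, y)] that agree elsewhere have images agreeing
    outside part [i0], so [P_determines] applies. *)
Lemma Kkm_copy_same_side (phi : 'I_k * 'I_m -> 'I_k * 'I_n) (i : 'I_k) (x y : 'I_m) :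
  is_Kkm_copy (transversal_edges P) phi -> (phi (i, x)).1 = i0 ->
  ((phi (i, x)).2 \in A) = ((phi (i, y)).2 \in A).
Proof.
move=> copy phi_i; have [p injp pE] := Kkm_copy_parts copy.
pose h (z : 'I_m) : {ffun 'I_k -> 'I_m} := upd [ffun=> x] i z.
have pi : p i = i0 by rewrite -(pE i x).
have imE z g : phi @: transversal (h z) = transversal g ->
    forall j, g (p j) = (phi (j, h z j)).2.
  move=> im j; apply/eqP; rewrite eq_sym -(pE j (h z j)).
  by rewrite -mem_transversal -im imset_f // mem_transversal.
have [g Pg /imE gE] := Kkm_copy_transversal (h x) copy.
have [g' Pg' /imE g'E] := Kkm_copy_transversal (h y) copy.
have [p' _ pK] := injF_bij injp.
have := P_determines Pg Pg'; rewrite -pi gE g'E !upd_same; apply => l neq.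
have neqi : p' l != i by apply: contra_neq neq => <-; rewrite pK.
by rewrite -(pK l) gE g'E !upd_other.
Qed.

(** Exactly one part of [K_k(m)] is sent to part [i0], and its [m] vertices land all in [A] or all
    outside. *)
Lemma Kkm_copy_dvdn (phi : 'I_k * 'I_m -> 'I_k * 'I_n) :
  is_Kkm_copy (transversal_edges P) phi ->
  (m %| #|[set phi x | x in [set: 'I_k * 'I_m]] :&: VA|)%N.
Proof.
move=> copy; have [injphi _] := copy; have [p injp pE] := Kkm_copy_parts copy.
have [p' _ pK] := injF_bij injp; pose i := p' i0.
have pi : p i = i0 by rewrite /i pK.
have im_part v : (v \in [set phi x | x in [set: 'I_k * 'I_m]]) -> v.1 = i0 ->
    exists x, v = phi (i, x).
  case/imsetP => -[j x] _ -> /=; rewrite pE -pi => /injp ->.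
  by exists x.
have [inA|notinA] := boolP ((phi (i, Ordinal m0)).2 \in A).
  have -> : [set phi x | x in [set: 'I_k * 'I_m]] :&: VA = [set phi (i, x) | x in 'I_m].
    apply/setP => v; apply/idP/imsetP => [|[x _ ->]].
      by rewrite !inE => /and3P[/im_part im /eqP/im[x ->] _]; exists x.
    rewrite !inE imset_f ?inE //= pE pi eqxx /=.
    by rewrite -(Kkm_copy_same_side (x := Ordinal m0)) // pE.
  by rewrite card_imset ?card_ord // => x y /injphi[].
rewrite (_ : _ :&: _ = set0) ?cards0 ?dvdn0 //; apply/setP => v; rewrite !inE.
apply/negbTE/and3P => -[/im_part im /eqP/im[x ->]].
by rewrite -(Kkm_copy_same_side (x := Ordinal m0)) ?pE // (negPf notinA).
Qed.

(** The disjoint copies of a factor cut [VA], a copy of [A], into pieces of size divisible by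
    [m]. *)
Lemma Kkm_factor_dvdn : has_Kkm_factor m (transversal_edges P) -> (m %| #|A|)%N.
Proof.
move=> [t [phi [copies [disj cov]]]].
pose F j := [set phi j x | x in [set: 'I_k * 'I_m]] :&: VA.
have <- : #|\bigcup_j F j| = #|A|.
  rewrite -(card_imset (mem A) (f := fun x => (i0, x))); last by move=> x y [].
  apply: eq_card => -[i x]; apply/bigcupP/imsetP => [[j _]|[y yA [-> ->]]].
    by rewrite !inE /= => /and3P[_ /eqP-> xA]; exists x.
  have [j [z phiz]] := cov (i0, y); exists j => //.
  by rewrite !inE /= eqxx yA andbT -phiz imset_f ?inE.
rewrite -sum1_card partition_disjoint_bigcup; last first.
  move=> j j' /disj; apply: disjointW; exact: subsetIl.
by apply: dvdn_sum => j _; rewrite sum1_card; exact: Kkm_copy_dvdn.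
Qed.

End Factor.

(** * Averaging over one or two coordinates *)

Section Resampling.
Variables (R : realFieldType) (k n : nat).
Local Notation point := {ffun 'I_k -> 'I_n}.

(* [(g, x) |-> (upd g j x, g j)] is an involution. *)
Lemma sum_upd (F : point -> R) (j : 'I_k) :
  \sum_g \sum_x F (upd g j x) = n%:R * \sum_g F g.
Proof.
pose swap (gx : point * 'I_n) := (upd gx.1 j gx.2, gx.1 j).
have swapK : involutive swap.
  by case=> g x; rewrite /swap /= upd_same upd_upd upd_id.
rewrite pair_bigA /= (reindex_inj (inv_inj swapK)) /=.
under eq_bigr do rewrite upd_upd upd_id.
rewrite -(pair_bigA _ (fun g _ => F g)) /= mulr_sumr.
by apply: eq_bigr => g _; rewrite sumr_const card_ord mulr_natl.
Qed.

(** Resampling coordinates [j] and [l] counts each point [n ^ 2] times, so a bound for every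
    two-dimensional slice bounds the full sum. *)
Lemma sum_upd2_le (F : point -> R) (j l : 'I_k) (B : R) :
  (forall g, `|\sum_x \sum_y F (upd (upd g j x) l y)| <= B) ->
  n%:R ^+ 2 * `|\sum_g F g| <= B * n%:R ^+ k.
Proof.
move=> leB; have n_ge0 : 0 <= n%:R :> R by [].
rewrite -[X in X * _](ger0_norm (sqr_ge0 _)) -normrM expr2 -mulrA.
rewrite -(sum_upd F l) -(sum_upd (fun g => \sum_x F (upd g l x)) j).
apply: le_trans (ler_norm_sum _ _ _) _.
apply: (@le_trans _ _ (\sum_(g : point) B)); first exact: ler_sum.
by rewrite sumr_const card_ffun !card_ord -[_ *+ _]mulr_natr natrX.
Qed.

End Resampling.

(** * Sums of [bent] along an equitable coloring *)

Section Colored.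
Variables (R : realFieldType) (d n : nat).
Local Notation A := {ffun 'I_d -> 'Z_4}.
Local Notation N := (4 ^+ d : R).
Variable c : 'I_n -> A.
Hypothesis c_equitable : forall a, `|(#|[pred x | c x == a]|%:R : R) - n%:R / N| <= 1.
Hypothesis N_le_n : N <= n%:R.

Lemma sum_colored (u : 'I_n -> R) (F : A -> R) :
  \sum_x u x * F (c x) = \sum_a (\sum_(x | c x == a) u x) * F a.
Proof.
rewrite (partition_big c predT) //=; apply: eq_bigr => a _.
by rewrite mulr_suml; apply: eq_bigr => x /eqP->.
Qed.

(** With all classes of size exactly [n / N] the sum would be [n / 2 ^ d]; each of the [N] colors
    adds an error of at most 1. *)
Lemma sum_bent_colored s : `|\sum_x bent R (c x + s)| <= n%:R / 2 ^+ d + N.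
Proof.
have p2 : 0 < 2 ^+ d :> R by rewrite exprn_gt0.
have e4 : N = 2 ^+ d * 2 ^+ d by rewrite -exprMn; congr (_ ^+ _); lra.
have -> : \sum_x bent R (c x + s) = n%:R / 2 ^+ d +
    \sum_(a : A) (#|[pred x | c x == a]|%:R - n%:R / N) * bent R (a + s).
  transitivity (\sum_(a : A) #|[pred x | c x == a]|%:R * bent R (a + s)).
    under eq_bigr do rewrite -[bent R _]mul1r.
    rewrite (sum_colored (fun=> 1) (fun a => bent R (a + s))).
    by apply: eq_bigr => a _; rewrite sumr_const.
  under [in RHS]eq_bigr do rewrite mulrBl.
  have sum_shift : \sum_(a : A) bent R (a + s) = 2 ^+ d.
    by rewrite -(sum_bent R d) [RHS](reindex_inj (addIr s)).
  rewrite sumrB -mulr_sumr sum_shift.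
  by rewrite e4; field; lra.
apply: le_trans (ler_normD _ _) _; apply: lerD.
  by rewrite ger0_norm // divr_ge0 // ltW.
apply: le_trans (ler_norm_sum _ _ _) _.
apply: (@le_trans _ _ (\sum_(a : A) 1)); last first.
  by rewrite sumr_const card_ffun !card_ord natrX.
apply: ler_sum => a _; rewrite normrM.
have -> : `|bent R (a + s)| = 1; last by rewrite mulr1.
by apply/eqP; rewrite -sqrp_eq1 // real_normK ?num_real // bent_sqr.
Qed.

(** Grouping by color reduces this to [bent_bilinear] with [W = 2 n / N]: a class has at most
    [n / N + 1] elements, and [N <= n]. *)
Lemma bent_bilinear_colored (u v : 'I_n -> R) s :
  (forall x, `|u x| <= 1) -> (forall x, `|v x| <= 1) ->
  `|\sum_x \sum_y u x * v y * bent R (c x + c y + s)| <= 4 * n%:R ^+ 2 / 2 ^+ d.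
Proof.
move=> leu lev.
have p2 : 0 < 2 ^+ d :> R by rewrite exprn_gt0.
have e4 : N = 2 ^+ d * 2 ^+ d by rewrite -exprMn; congr (_ ^+ _); lra.
have N0 : 0 < N by rewrite exprn_gt0.
have weight (w : 'I_n -> R) a : (forall x, `|w x| <= 1) ->
    `|\sum_(x | c x == a) w x| <= 2 * n%:R / N.
  move=> lew; apply: le_trans (ler_norm_sum _ _ _) _.
  apply: (@le_trans _ _ (\sum_(x | c x == a) 1)); first exact: ler_sum.
  rewrite sumr_const; apply: (@le_trans _ _ (n%:R / N + 1)).
    by rewrite addrC -lerBlDr; apply: le_trans (c_equitable a); rewrite ler_norm.
  have : 1 <= n%:R / N by rewrite ler_pdivlMr // mul1r.
  by rewrite -mulrA; lra.
have -> : \sum_x \sum_y u x * v y * bent R (c x + c y + s) =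
    \sum_(a : A) \sum_(b : A) (\sum_(x | c x == a) u x) *
       (\sum_(y | c y == b) v y) * bent R (a + b + s).
  pose G (a : A) := \sum_y v y * bent R (a + c y + s).
  transitivity (\sum_x u x * G (c x)).
    by apply: eq_bigr => x _; rewrite mulr_sumr; apply: eq_bigr => y _; rewrite mulrA.
  rewrite sum_colored; apply: eq_bigr => a _.
  rewrite /G (sum_colored v (fun b => bent R (a + b + s))) mulr_sumr.
  by apply: eq_bigr => b _; rewrite mulrA.
apply: le_trans (bent_bilinear _ (fun a => weight u a leu) (fun b => weight v b lev)) _.
rewrite le_eqVlt; apply/orP; left; apply/eqP.
by rewrite e4; field; lra.
Qed.

End Colored.

(** * A side of nearly half size *)

Lemma exists_nearly_half_not_dvdn (m n : nat) : (1 < m)%N -> (1 < n)%N ->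
  exists2 A : {set 'I_n}, ~~ (m %| #|A|)%N & (#|A|.*2 <= n + 2)%N && (n <= #|A|.*2 + 1)%N.
Proof.
(* Since [m > 1], it cannot divide two consecutive integers. *)
move=> m1 n1; pose a := if (m %| n./2)%N then n./2.+1 else n./2.
have le_an : (a <= n)%N by rewrite /a; case: ifP; lia.
have inj : injective (widen_ord le_an) by move=> x y /(congr1 val) /= ?; apply: val_inj.
exists [set widen_ord le_an x | x in 'I_a].
all: rewrite (card_imset _ inj) card_ord.
  rewrite /a; case: ifP => [dv|->] //; apply/negP => dvS.
  by have := dvdn_sub dvS dv; rewrite subSnn dvdn1 => /eqP; lia.
by rewrite /a; case: ifP; lia.
Qed.

(** * The sign hypergraph: rigidity and degrees *)

Section SignGraph.
Variables (R : realType) (k n d : nat).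
Local Notation point := {ffun 'I_k -> 'I_n}.
Local Notation N := (4 ^+ d : R).
Variables (c : 'I_n -> {ffun 'I_d -> 'Z_4}) (A : {set 'I_n}) (i0 : 'I_k).
Hypothesis c_equitable : forall a, `|(#|[pred x | c x == a]|%:R : R) - n%:R / N| <= 1.
Hypothesis N_le_n : N <= n%:R.

Definition side (x : 'I_n) : R := (-1) ^+ (x \notin A).

Definition chi (g : point) : R := side (g i0) * bent R (\sum_(i | i != i0) c (g i)).

Definition positive : pred point := [pred g | chi g == 1].

Lemma chi_sqr g : chi g ^+ 2 = 1.
Proof. by rewrite exprMn bent_sqr sqrr_sign mulr1. Qed.

Lemma side_norm x : `|side x| = 1.
Proof. by rewrite normr_sign. Qed.

(** This affine form of the indicator turns degrees and box counts into sums of [chi]. *)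
Lemma positiveE g : (positive g)%:R = (1 + chi g) / 2.
Proof.
rewrite /positive inE; have /eqP := chi_sqr g; rewrite sqrf_eq1 => /orP[] /eqP ->.
  by rewrite eqxx mulr1n; lra.
have -> : (-1 == 1 :> R) = false by apply/eqP; lra.
by rewrite mulr0n; lra.
Qed.

(** The coordinates other than [i0] fix the nonzero [bent] factor, so [chi = 1] leaves one value for
    [side]. *)
Lemma positive_determines g g' : positive g -> positive g' ->
  (forall i, i != i0 -> g i = g' i) -> (g i0 \in A) = (g' i0 \in A).
Proof.
rewrite /positive !inE => /eqP chi1 /eqP chi1' agree.
have : chi g = chi g' by rewrite chi1 chi1'.
rewrite /chi (eq_bigr (fun i => c (g' i))) => [|i /agree-> //].
have b0 : bent R (\sum_(i | i != i0) c (g' i)) != 0.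
  by rewrite -sqrf_eq0 bent_sqr oner_eq0.
move/(mulIf b0); rewrite /side.
by case: (g i0 \in A); case: (g' i0 \in A) => //=; rewrite expr0 expr1; lra.
Qed.

Lemma sum_side : \sum_x side x = #|A|%:R *+ 2 - n%:R.
Proof.
rewrite (bigID (mem A)) /=.
rewrite (eq_bigr (fun=> 1)); last by move=> x xA; rewrite /side xA.
rewrite [X in _ + X](eq_bigr (fun=> -1)); last by move=> x xA; rewrite /side xA.
rewrite sumr_const sumrN sumr_const.
have <- : (#|A| + #|[predC A]|)%:R = n%:R :> R by rewrite cardC card_ord.
rewrite natrD (_ : #|[predC A]| = #|(fun x => x \notin A)|); first by ring.
exact: eq_card.
Qed.

(** If [j = i0], only [side] varies and the balance of [A] gives 2; otherwise only [bent] varies and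
    [sum_bent_colored] applies. The bound covers both cases. *)
Lemma sum_chi_upd g j : `|#|A|%:R *+ 2 - n%:R| <= (2 : R) ->
  `|\sum_x chi (upd g j x)| <= n%:R / 2 ^+ d + N + 2.
Proof.
move=> bal; have p2 : 0 < 2 ^+ d :> R by rewrite exprn_gt0.
have p4 : 0 < N by rewrite exprn_gt0.
have pn : 0 <= n%:R / 2 ^+ d :> R by rewrite divr_ge0 // ltW.
have [->|neq] := eqVneq j i0.
  have -> : \sum_x chi (upd g i0 x) =
      (\sum_x side x) * bent R (\sum_(i | i != i0) c (g i)).
    rewrite mulr_suml; apply: eq_bigr => x _; rewrite /chi upd_same.
    by congr (_ * bent _ _); apply: eq_bigr => i neq; rewrite upd_other.
  have b1 : `|bent R (\sum_(i | i != i0) c (g i))| = 1.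
    by apply/eqP; rewrite -sqrp_eq1 // real_normK ?num_real // bent_sqr.
  by rewrite normrM b1 mulr1 sum_side; lra.
have -> : \sum_x chi (upd g j x) = side (g i0) *
    \sum_x bent R (c x + \sum_(i | (i != i0) && (i != j)) c (g i)).
  rewrite mulr_sumr; apply: eq_bigr => x _; rewrite /chi upd_other 1?eq_sym //.
  rewrite (bigD1 j) //= upd_same; congr (_ * bent _ (_ + _)).
  by apply: eq_bigr => i /andP[_ nj]; rewrite upd_other.
rewrite normrM side_norm mul1r.
by have := sum_bent_colored c_equitable
  (\sum_(i | (i != i0) && (i != j)) c (g i)); lra.
Qed.

Lemma positive_min_deg (mu : R) : (0 < k)%N -> (0 < n)%N ->
  `|#|A|%:R *+ 2 - n%:R| <= (2 : R) ->
  n%:R / 2 ^+ d + N + 2 <= 2 * mu * n%:R ->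
  partite_min_deg_ge (transversal_edges positive) k.-1 ((1 / 2 - mu) * n%:R).
Proof.
move=> k0 n0 bal small S legS cardS.
have [g [j]] := deg_transversal_edges positive k0 n0 legS cardS.
rewrite -(ler_nat R); apply: le_trans.
have -> : (#|[pred x | positive (upd g j x)]|%:R : R) =
    (n%:R + \sum_x chi (upd g j x)) / 2.
  rewrite -sum1_card natr_sum big_mkcond /=.
  transitivity (\sum_(x < n) (1 + chi (upd g j x)) / 2).
    by apply: eq_bigr => x _; rewrite -positiveE inE; case: (positive _).
  by rewrite -mulr_suml big_split sumr_const card_ord.
have := sum_chi_upd g j bal; rewrite ler_norml => /andP[lb _].
lra.
Qed.

(** * Discrepancy of boxes *)

Section Density.
Variables (i1 i2 : 'I_k).
Hypotheses (neq10 : i1 != i0) (neq20 : i2 != i0) (neq21 : i2 != i1).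

(** Once all coordinates but [i1] and [i2] are fixed, [side] and the other indicators are constants
    of modulus at most 1, and a bilinear form in 0/1 weights remains. *)
Lemma sum_chi_box (Y : 'I_k -> {set 'I_n}) : (0 < n)%N ->
  `|\sum_(g : point) (\prod_i (g i \in Y i)%:R) * chi g| <= 4 * n%:R ^+ k / 2 ^+ d.
Proof.
move=> n0; have n2 : 0 < n%:R ^+ 2 :> R by rewrite exprn_gt0 // ltr0n.
rewrite -(ler_pM2l n2).
have -> : n%:R ^+ 2 * (4 * n%:R ^+ k / 2 ^+ d) = 4 * n%:R ^+ 2 / 2 ^+ d * n%:R ^+ k :> R.
  ring.
apply: (sum_upd2_le (j := i1) (l := i2)) => g.
pose rest := \prod_(i | (i != i1) && (i != i2)) (g i \in Y i)%:R : R.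
pose s := \sum_(i | [&& i != i0, i != i1 & i != i2]) c (g i).
have -> : \sum_x \sum_y (\prod_i (upd (upd g i1 x) i2 y i \in Y i)%:R) *
      chi (upd (upd g i1 x) i2 y) =
    rest * side (g i0) * \sum_x \sum_y
      (x \in Y i1)%:R * (y \in Y i2)%:R * bent R (c x + c y + s).
  rewrite mulr_sumr; apply: eq_bigr => x _; rewrite mulr_sumr; apply: eq_bigr => y _.
  have -> : \prod_i (upd (upd g i1 x) i2 y i \in Y i)%:R =
      (x \in Y i1)%:R * (y \in Y i2)%:R * rest.
    rewrite (bigD1 i1) //= (bigD1 i2) //= mulrA upd_same upd_other 1?eq_sym // upd_same.
    by congr (_ * _); apply: eq_bigr => i /andP[ni1 ni2]; rewrite !upd_other.
  have -> : chi (upd (upd g i1 x) i2 y) = side (g i0) * bent R (c x + c y + s).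
    rewrite /chi !upd_other 1?eq_sym // (bigD1 i1) //= (bigD1 i2) /=; last first.
      by rewrite neq20.
    rewrite addrA upd_same upd_other 1?eq_sym // upd_same.
    congr (_ * bent _ (_ + _)); rewrite -[s]/(\sum_(_ | _) _).
    under eq_bigl do rewrite -andbA.
    by apply: eq_bigr => i /and3P[_ ni1 ni2]; rewrite !upd_other.
  ring.
rewrite !normrM side_norm mulr1.
have rest1 : `|rest| <= 1.
  rewrite normr_prod; apply: prodr_ile1 => i _.
  by rewrite normr_ge0 normr_nat lern1 leq_b1.
apply: le_trans (ler_piMl _ rest1) _ => //.
by apply: bent_bilinear_colored => // x; rewrite normr_nat lern1 leq_b1.
Qed.

Lemma positive_dense (mu : R) : (0 < k)%N -> (0 < n)%N -> 2 / 2 ^+ d <= mu ->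
  dense (transversal_edges positive) (1 / 2) mu.
Proof.
move=> k0 n0 small X subX; pose Y i := [set x | (i, x) \in X i].
have cardX i : #|X i| = #|Y i|.
  rewrite -(card_imset (mem (Y i)) (f := pair i)); last by move=> x y [].
  apply: eq_card => -[j x]; apply/idP/imsetP => [xX|[y yY ->]].
    have /(subsetP (subX i)) := xX; rewrite inE => /eqP /= eji.
    by move: xX; rewrite eji => xX; exists x; rewrite ?inE.
  by rewrite inE in yY.
have eE : (e_H (transversal_edges positive) X)%:R =
    (\prod_i (#|X i|%:R : R) + \sum_(g : point) (\prod_i (g i \in Y i)%:R) * chi g) / 2.
  rewrite e_H_transversal_edges // -sum1_card natr_sum big_mkcond /=.
  have -> : \prod_i (#|X i|%:R : R) = \sum_(g : point) \prod_i (g i \in Y i)%:R.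
    rewrite -(bigA_distr_bigA (fun i x => (x \in Y i)%:R)) /=.
    apply: eq_bigr => i _; rewrite cardX -sum1_card natr_sum big_mkcond /=.
    by apply: eq_bigr => x _; case: (x \in _).
  rewrite -big_split mulr_suml; apply: eq_bigr => g _ /=; rewrite inE.
  have -> : \prod_i (g i \in Y i)%:R = [forall i, (i, g i) \in X i]%:R :> R.
    case: (boolP [forall i, _]) => [/forallP gX|/forallPn[i /negPf giX]].
      by rewrite big1 // => i _; rewrite inE gX.
    by rewrite (bigD1 i) //= inE giX mul0r.
  rewrite -[X in X + _]mulr1 -mulrDr -mulrA -positiveE -natrM mulnb.
  by case: (_ && _).
have := sum_chi_box Y n0; rewrite ler_norml => /andP[lb _].
have nk0 : 0 <= n%:R ^+ k :> R by rewrite exprn_ge0.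
(* Half of the discrepancy bound from [sum_chi_box] must fit into the error allowed by density. *)
have : 2 / 2 ^+ d * n%:R ^+ k <= mu * (k * n)%:R ^+ k.
  apply: ler_pM => //; first by rewrite divr_ge0 // exprn_ge0.
  by rewrite lerXn2r ?nnegrE // ler_nat leq_pmull.
rewrite eE; lra.
Qed.

End Density.
End SignGraph.

(** * Choice of parameters *)

Theorem theorem1p2 (R : realType) (k m : nat) (mu : R) :
  (3 <= k)%N -> (2 <= m)%N -> 0 < mu ->
  exists n0 : nat, forall n : nat, (n0 <= n)%N ->
    exists E : {set {set 'I_k * 'I_n}},
      is_kpartite_kgraph E /\
      dense E (1 / 2) mu /\
      partite_min_deg_ge E k.-1 ((1 / 2 - mu) * n%:R) /\
      ~ has_Kkm_factor m E.
Proof.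
(* From [2 / mu < d <= 2 ^ d] one gets [2 / 2 ^ d <= mu]. *)
move=> k3 m2 mu0; pose d := Num.bound (2 / mu).
have p2 : 0 < 2 ^+ d :> R by rewrite exprn_gt0.
have p4 : 0 < 4 ^+ d :> R by rewrite exprn_gt0.
have small : 2 / 2 ^+ d <= mu.
  have lt_d : 2 / mu < d%:R by rewrite archi_boundP // divr_ge0 // ltW.
  have le_d : d%:R <= 2 ^+ d :> R by rewrite -natrX ler_nat ltnW // ltn_expl.
  rewrite ler_pdivrMr // mulrC -ler_pdivrMr //.
  exact/ltW/(lt_le_trans lt_d).
(* The first term gives [N <= n], the two quotients give [4 ^ d + 2 <= mu * n], and the last term
   gives [n > 1]. *)
pose x0 : R := 4 ^+ d + 4 ^+ d / mu + 2 / mu + 2.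
have q4 : 0 < 4 ^+ d / mu by rewrite divr_gt0.
have q2 : 0 < 2 / mu by rewrite divr_gt0.
exists (Num.bound x0) => n le_n.
have {le_n} lt_n : x0 < n%:R.
  apply: (@lt_le_trans _ _ (Num.bound x0)%:R); last by rewrite ler_nat.
  by rewrite archi_boundP // /x0; lra.
have N_le_n : 4 ^+ d <= n%:R :> R by move: lt_n; rewrite /x0; lra.
have n1 : (1 < n)%N by rewrite -(ltr_nat R); move: lt_n; rewrite /x0; lra.
have [|c c_eq] := @equitable_coloring R {ffun 'I_d -> 'Z_4} n.
  by rewrite card_ffun !card_ord expn_gt0.
have {}c_eq a : `|(#|[pred x | c x == a]|%:R : R) - n%:R / 4 ^+ d| <= 1.
  by have := c_eq a; rewrite card_ffun !card_ord natrX.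
have [A mA /andP[A_ub A_lb]] := exists_nearly_half_not_dvdn m2 n1.
have bal : `|#|A|%:R *+ 2 - n%:R| <= (2 : R).
  move: A_ub A_lb; rewrite -(ler_nat R) -[(n <= _)%N](ler_nat R) -muln2 !natrD natrM.
  by rewrite ler_norml; lra.
have k0 : (0 < k)%N by lia.
pose i0 := Ordinal k0.
have k1 : (1 < k)%N by lia.
exists (transversal_edges (positive R c A i0)); split; last split; last split.
- exact: transversal_edges_kpartite.
- by apply: (positive_dense _ c_eq N_le_n (i1 := Ordinal k1) (i2 := Ordinal k3)) => //;
    exact: ltnW.
- apply: positive_min_deg => //; first exact: ltnW.
  (* The degree error is at most [mu * n / 2 + mu * n], within the allowed [2 * mu * n]. *)
  have l1 : n%:R / 2 ^+ d <= mu / 2 * n%:R.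
    by rewrite mulrC; apply: ler_wpM2r => //; lra.
  have : 4 ^+ d + 2 <= mu * n%:R.
    rewrite mulrC -ler_pdivrMr // mulrDl; move: lt_n; rewrite /x0; lra.
  have : 0 <= mu * n%:R by rewrite mulr_ge0 // ltW.
  lra.
- move=> factor; move/negP: mA; apply.
  apply: (Kkm_factor_dvdn (ltnW m2) (positive_determines (i0 := i0)) factor).
Qed.
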